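(* Let a Boolean control network $x(t+1)=Lu(t)x(t)$, $y(t)=Hx(t)$ be given, let $\mathcal{G}=(\mathcal{V},\mathcal{E},\mathcal{W})$ be its weighted pair graph and let $\mathcal{V}_n$ be the set of all non-diagonal vertices of $\mathcal{G}$. The network is not Type-3 observable if and only if the deterministic finite automaton $A_{\mathcal{V}_n}$ is complete.
   Context: Fix positive integers $n,m,q$ and put $N=2^n$, $M=2^m$, $Q=2^q$. For a positive integer $k$, $\delta_k^i$ is the $i$-th column of the identity matrix $I_k$ and $\Delta_k=\{\delta_k^1,\dots,\delta_k^k\}$. A logical matrix of size $k\times s$ is one all of whose columns lie in $\Delta_k$. A Boolean control network (BCN, in algebraic form) is a system $x(t+1)=Lu(t)x(t)$, $y(t)=Hx(t)$, $t=0,1,2,\dots$, with states $x(t)\in\Delta_N$, inputs $u(t)\in\Delta_M$, outputs $y(t)\in\Delta_Q$, where $L$ is an $N\times NM$ logical matrix and $H$ is a $Q\times N$ logical matrix. Products are semi-tensor products; concretely $Lux=L(u\otimes x)$ for $u\in\Delta_M$, $x\in\Delta_N$, with $\otimes$ the Kronecker product. For $x_0\in\Delta_N$, $p\ge 1$ and $U=u_0\cdots u_{p-1}\in(\Delta_M)^p$, put $x_{t+1}=Lu_tx_t$ for $0\le t<p$ and $(HL)_{x_0}^p(U)=(Hx_1)\cdots(Hx_p)\in(\Delta_Q)^p$. Type-3 observability: there exist $p\ge1$ and $U\in(\Delta_M)^p$ such that for any distinct $x_0,\bar x_0\in\Delta_N$, $Hx_0=H\bar x_0$ implies $(HL)_{x_0}^p(U)\neq(HL)_{\bar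 x_0}^p(U)$. Weighted pair graph $\mathcal{G}=(\mathcal{V},\mathcal{E},\mathcal{W})$: $\mathcal{V}$ is the set of unordered pairs $(x,x')$ (so $(x,x')=(x',x)$, and $x=x'$ is allowed) of elements of $\Delta_N$ with $Hx=Hx'$. For vertices $v=(x_1,x_1')$, $w=(x_2,x_2')$, let $\mathcal{W}((v,w))$ be the set of $u\in\Delta_M$ such that ($Lux_1=x_2$ and $Lux_1'=x_2'$) or ($Lux_1=x_2'$ and $Lux_1'=x_2$). The directed edge $(v,w)$ belongs to $\mathcal{E}$ iff this set is nonempty, and then it is the weight of the edge. A vertex $(x,x)$ is called diagonal; the other vertices are non-diagonal. A deterministic finite automaton (DFA) is $A=(S,\Sigma,\sigma,s_0,F)$ with finite state set $S$, finite nonempty alphabet $\Sigma$, initial state $s_0\in S$, final states $F\subset S$, and a partial transition function $\sigma:S\times\Sigma\to S$. It is complete if $\sigma$ is a total function (defined at every pair $(s,a)\in S\times\Sigma$, equivalently its natural extension to $S\times\Sigma^*$ is total). The DFA $A_{\mathcal{V}_n}$: its alphabet is $\Delta_M$; its states are subsets of $\mathcal{V}$; its initial state is $\mathcal{V}_n$. For a state $s$ and a letter $\delta_M^j$, let $s'=\{v\in\mathcal{V}\mid \text{there is } v'\in s\text{ with }(v',v)\in\mathcal{E}\text{ and }\delta_M^j\in\mathcal{W}((v',v))\}$; if $s'\neq\emptyset$ then the transition function at $(s,\delta_M^j)$ takes the value $s'$, and otherwise it is undefined there. The state set consists of $\mathcal{V}_n$ and all sets obtained from it by repeatedly applying these transitions.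 All states are final. *)

(* Defs.v *)
From HB Require Import structures.
From mathcomp Require Import all_boot all_algebra.
From mathcomp Require Import mxtens.

Set Implicit Arguments.
Unset Strict Implicit.
Unset Printing Implicit Defensive.

Import GRing.Theory.
Local Open Scope ring_scope.

(* Ordinals start at 0, so delta_k^i is [delta_mx i 0] with i shifted by one. *)
Definition delta_seq (k : nat) : seq 'cV[int]_k :=
  codom (fun i : 'I_k => delta_mx i 0 : 'cV[int]_k).

(* [val : Delta k -> 'cV[int]_k] recovers the column vector. *)
Definition Delta (k : nat) : finType := seq_sub (delta_seq k).

Definition logical_mx (k s : nat) (A : 'M[int]_(k, s)) : bool :=
  [forall j : 'I_s, col j A \in delta_seq k].

(* The size of [bcn_L] is written so as to match that of [u *t x]. *)
Record bcn (n m q : nat) := Bcn {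
  bcn_L : 'M[int]_(2 ^ n, 2 ^ m * 2 ^ n);
  bcn_H : 'M[int]_(2 ^ q, 2 ^ n);
  bcn_L_logical : logical_mx bcn_L;
  bcn_H_logical : logical_mx bcn_H
}.

Section BooleanControlNetwork.

Context {n m q : nat} (B : bcn n m q).

Implicit Types (u : Delta (2 ^ m)) (x : 'cV[int]_(2 ^ n)).

(* [*t] is the Kronecker product; [u *t x] has 1 * 1 columns. *)
Definition bcn_step x u : 'cV[int]_(2 ^ n) :=
  bcn_L B *m (val u *t x : 'cV[int]_(2 ^ m * 2 ^ n)).

Definition bcn_out x : 'cV[int]_(2 ^ q) := bcn_H B *m x.

(* [scanl] leaves out the initial state: the outputs are those at times
   1, ..., p. *)
Definition bcn_outputs x (U : seq (Delta (2 ^ m))) : seq 'cV[int]_(2 ^ q) :=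
  [seq bcn_out y | y <- scanl bcn_step x U].

Definition type3_observable : Prop :=
  exists p : nat, (0 < p)%N /\
  exists U : p.-tuple (Delta (2 ^ m)),
  forall x0 x0' : Delta (2 ^ n), x0 <> x0' ->
    bcn_out (val x0) = bcn_out (val x0') ->
    bcn_outputs (val x0) U <> bcn_outputs (val x0') U.

(* The unordered pair (x, x') is the set {x, x'}, a singleton when x = x'. *)
Definition upair : finType := {set Delta (2 ^ n)}.

Definition mk_upair (y y' : Delta (2 ^ n)) : upair := [set y; y'].

Definition pair_vertices : {set upair} :=
  [set v | [exists y, exists y',
     (v == mk_upair y y') && (bcn_out (val y) == bcn_out (val y'))]].

Definition pair_weight (v w : upair) : {set Delta (2 ^ m)} :=
  [set u | [exists y1, exists y1', exists y2, exists y2',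
     [&& v == mk_upair y1 y1', w == mk_upair y2 y2' &
         (bcn_step (val y1) u == val y2) && (bcn_step (val y1') u == val y2')
      || (bcn_step (val y1) u == val y2') && (bcn_step (val y1') u == val y2)]]].

Definition pair_edges : {set upair * upair} :=
  [set e | [&& e.1 \in pair_vertices, e.2 \in pair_vertices &
               pair_weight e.1 e.2 != set0]].

Definition diagonal (v : upair) : bool := [exists y, v == mk_upair y y].

Definition nondiagonal_vertices : {set upair} :=
  [set v in pair_vertices | ~~ diagonal v].

End BooleanControlNetwork.

(* The state set S is a subset [dfa_states] of an ambient finite type T; the
   partial transition function is only meaningful on S, where it must take its
   values in S ([None] meaning undefined). *)
Record dfa (T Sigma : finType) := Dfa {
  dfa_states : {set T};
  dfa_trans : T -> Sigma -> option T;
  dfa_init : T;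
  dfa_final : {set T};
  dfa_alphabet_nonempty : (0 < #|Sigma|)%N;
  dfa_trans_closed : forall s a t,
    s \in dfa_states -> dfa_trans s a = Some t -> t \in dfa_states;
  dfa_init_in : dfa_init \in dfa_states;
  dfa_final_sub : dfa_final \subset dfa_states
}.

Definition dfa_complete (T Sigma : finType) (A : dfa T Sigma) : Prop :=
  forall (s : T) (a : Sigma), s \in dfa_states A ->
  exists t : T, dfa_trans A s a = Some t.

Section PairAutomaton.

Context {n m q : nat} (B : bcn n m q).

Definition pair_succ (s : {set @upair n}) (u : Delta (2 ^ m)) : {set @upair n} :=
  [set v in pair_vertices B | [exists v' in s,
     ((v', v) \in pair_edges B) && (u \in pair_weight B v' v)]].

Definition pair_trans (s : {set @upair n}) (u : Delta (2 ^ m)) :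
    option {set @upair n} :=
  if pair_succ s u != set0 then Some (pair_succ s u) else None.

(* [connect] is the reflexive transitive closure. *)
Definition pair_states : {set {set @upair n}} :=
  [set s | connect (fun s1 s2 => [exists u, pair_trans s1 u == Some s2])
             (nondiagonal_vertices B) s].

Lemma Delta_gt0 : (0 < #|Delta (2 ^ m)|)%N.
Proof.
have k_gt0 : (0 < 2 ^ m)%N by rewrite expn_gt0.
by apply/card_gt0P; exists (SeqSub (codom_f _ (Ordinal k_gt0))).
Qed.

Lemma pair_trans_closed (s : {set @upair n}) (u : Delta (2 ^ m)) t :
  s \in pair_states -> pair_trans s u = Some t -> t \in pair_states.
Proof.
rewrite !inE => con_s tr_s; apply: connect_trans con_s _.
by apply: connect1; apply/existsP; exists u; apply/eqP.
Qed.

Lemma pair_init_in : nondiagonal_vertices B \in pair_states.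
Proof. by rewrite inE connect0. Qed.

Definition pair_dfa : dfa {set @upair n} (Delta (2 ^ m)) :=
  Dfa Delta_gt0 pair_trans_closed pair_init_in (subxx pair_states).

End PairAutomaton.

(* Main.v *)
Require Import Defs.
From mathcomp Require Import all_boot all_algebra.
From mathcomp Require Import mxtens.

(** A letter [u] moves the two states of a pair simultaneously, and the pair
graph keeps the resulting pair exactly when the two new states have the same
output. Hence the state that [A_{V_n}] reaches on an input word [U] consists of
the pairs produced by those distinct, output-equivalent initial states whose
outputs agree all along [U]; it is empty if and only if [U] tells apart all such
initial states ([foldl_pair_succ_neq0], [distinguishing_word]). So the network
fails to be Type-3 observable if and only if no nonempty word leads to the empty
set ([type3_observableP]).

The automaton omits a transition precisely when its target would be empty. If it
is complete, every state has a nonempty successor, hence is itself nonempty, and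
by induction every word leads to a state. Conversely, every state [s] is reached
by some word [U], and if no nonempty word leads to the empty set then [U]
followed by any letter [a] does not, which says that the transition from [s]
under [a] is defined. *)

Set Implicit Arguments.
Unset Strict Implicit.
Unset Printing Implicit Defensive.

Import GRing.Theory.

Section PairGraph.

Context {n m q : nat} (B : bcn n m q).

Implicit Types (y z : Delta (2 ^ n)) (u : Delta (2 ^ m)) (v w : @upair n).
Implicit Types (s : {set @upair n}) (U : seq (Delta (2 ^ m))).

(** The Kronecker product of two canonical vectors is canonical, so that the
network selects a column of its logical matrix. *)
Lemma bcn_step_delta y u : bcn_step B (val y) u \in delta_seq (2 ^ n).
Proof.
have /codomP[j yE] := valP y; have /codomP[i uE] := valP u.
have -> : bcn_step B (val y) u = col (mxtens_index (i, j)) (bcn_L B).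
  rewrite /bcn_step yE uE colE; congr (_ *m _)%R.
  apply/matrixP=> k l; case: (mxtens_indexP k) => k1 k2.
  rewrite !mxE mxtens_indexK /= !ord1 !eqxx !andbT.
  by rewrite (can_eq (@mxtens_indexK _ _)) xpair_eqE -natrM mulnb.
exact: forallP (bcn_L_logical B) _.
Qed.

Definition step y u : Delta (2 ^ n) := SeqSub (bcn_step_delta y u).

Lemma bcn_step_eq y u z : (bcn_step B (val y) u == val z) = (z == step y u).
Proof. by rewrite eq_sym. Qed.

Lemma bcn_outputs_cons y u U :
  bcn_outputs B (val y) (u :: U) =
    bcn_out B (val (step y u)) :: bcn_outputs B (val (step y u)) U.
Proof. by []. Qed.

Lemma mk_upairC y z : mk_upair y z = mk_upair z y.
Proof. exact: setUC. Qed.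

Lemma mk_upair_inj y y' z z' : mk_upair y y' = mk_upair z z' ->
  y = z /\ y' = z' \/ y = z' /\ y' = z.
Proof.
move=> E.
have /set2P yz : y \in mk_upair z z' by rewrite -E set21.
have /set2P yz' : y' \in mk_upair z z' by rewrite -E set22.
have /set2P zy : z \in mk_upair y y' by rewrite E set21.
have /set2P zy' : z' \in mk_upair y y' by rewrite E set22.
by intuition congruence.
Qed.

Lemma pair_verticesP v :
  reflect (exists y y', v = mk_upair y y' /\
             bcn_out B (val y) = bcn_out B (val y'))
          (v \in pair_vertices B).
Proof.
rewrite inE; apply: (iffP existsP) => [[y /existsP[y' /andP[/eqP-> /eqP]]]|].
  by exists y, y'.
by case=> y [y' [-> o]]; exists y; apply/existsP; exists y'; rewrite o !eqxx.
Qed.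

Lemma mk_upair_vertex y y' :
  (mk_upair y y' \in pair_vertices B) =
    (bcn_out B (val y) == bcn_out B (val y')).
Proof.
apply/pair_verticesP/eqP => [[z [z' [/mk_upair_inj[] [-> ->] //]]]|o].
by exists y, y'.
Qed.

Lemma mk_upair_nondiagonal y y' :
  (mk_upair y y' \in nondiagonal_vertices B) =
    (bcn_out B (val y) == bcn_out B (val y')) && (y != y').
Proof.
rewrite inE mk_upair_vertex; congr (_ && ~~ _).
apply/existsP/eqP => [[z /eqP/mk_upair_inj[] [-> ->] //]|->].
by exists y'.
Qed.

(** Edges are given by a function: the letter [u] labels exactly one candidate
edge out of a pair, the one to the pair of images. *)
Lemma pair_weight_mk y y' w u :
  (u \in pair_weight B (mk_upair y y') w) =
    (w == mk_upair (step y u) (step y' u)).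
Proof.
apply/idP/eqP=> [|->]; rewrite inE.
  case/existsP=> y1 /existsP[y1' /existsP[y2 /existsP[y2']]].
  case/and3P=> /eqP/mk_upair_inj E /eqP-> /orP.
  rewrite !bcn_step_eq.
  by case: E => -[-> ->] [] /andP[/eqP-> /eqP->] //; apply: mk_upairC.
apply/existsP; exists y; apply/existsP; exists y'.
apply/existsP; exists (step y u); apply/existsP; exists (step y' u).
by rewrite !bcn_step_eq !eqxx.
Qed.

Lemma pair_succ_sub s u : pair_succ B s u \subset pair_vertices B.
Proof. by apply/subsetP=> w; rewrite inE => /andP[]. Qed.

Lemma pair_succP s u w : s \subset pair_vertices B ->
  reflect (exists y y',
             [/\ mk_upair y y' \in s, w = mk_upair (step y u) (step y' u)
               & bcn_out B (val (step y u)) = bcn_out B (val (step y' u))])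
          (w \in pair_succ B s u).
Proof.
move=> sV; apply: (iffP idP); rewrite inE.
  case/andP=> wV /existsP[v /and3P[vs _ uvw]].
  have /pair_verticesP[y [y' [vE _]]] := subsetP sV _ vs.
  move: vs uvw wV; rewrite vE pair_weight_mk => vs /eqP->.
  by rewrite mk_upair_vertex => /eqP; exists y, y'.
case=> y [y' [vs wE o]].
have wV : w \in pair_vertices B by rewrite wE mk_upair_vertex o.
have uvw : u \in pair_weight B (mk_upair y y') w.
  by rewrite pair_weight_mk wE.
rewrite wV; apply/existsP; exists (mk_upair y y').
rewrite vs uvw inE /= wV (subsetP sV) //= andbT.
by apply/set0Pn; exists u.
Qed.

(** A pair in the final set is traced back along the word to a pair in [s]. The
set [s] must be arbitrary for the induction on [U], since the first letter
replaces it by its successor. *)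
Lemma foldl_pair_succ_neq0 s U : s \subset pair_vertices B ->
  reflect (exists y y', mk_upair y y' \in s /\
             bcn_outputs B (val y) U = bcn_outputs B (val y') U)
          (foldl (pair_succ B) s U != set0).
Proof.
elim: U s => [|u U IH] s sV /=.
  apply: (iffP (set0Pn _)) => [[v vs]|[y [y' [vs _]]]]; last by exists (mk_upair y y').
  have /pair_verticesP[y [y' [vE _]]] := subsetP sV _ vs.
  by exists y, y'; rewrite -vE.
apply: (iffP (IH _ (pair_succ_sub s u))) => [[z [z' []]]|[y [y' [vs]]]].
  case/(pair_succP _ _ sV)=> y [y' [vs zE o]] oU; exists y, y'; split=> //.
  rewrite !bcn_outputs_cons o.
  by case: (mk_upair_inj zE) oU => -[-> ->] ->.
rewrite !bcn_outputs_cons => -[o oU].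
exists (step y u), (step y' u); split=> //.
by apply/(pair_succP _ _ sV); exists y, y'.
Qed.

Lemma distinguishing_word U :
  foldl (pair_succ B) (nondiagonal_vertices B) U = set0 <->
  forall y y', y <> y' -> bcn_out B (val y) = bcn_out B (val y') ->
    bcn_outputs B (val y) U <> bcn_outputs B (val y') U.
Proof.
have VnV : nondiagonal_vertices B \subset pair_vertices B.
  by apply/subsetP=> v; rewrite inE => /andP[].
split=> [U0 y y' /eqP neq o oU|dist].
  move/eqP: U0; apply/negP/(foldl_pair_succ_neq0 _ VnV); exists y, y'.
  by rewrite mk_upair_nondiagonal o eqxx.
apply/eqP; apply: contraT => /(foldl_pair_succ_neq0 _ VnV)[y [y' []]].
by rewrite mk_upair_nondiagonal => /andP[/eqP o /eqP neq] /(dist _ _ neq o).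
Qed.

Lemma type3_observableP :
  type3_observable B <->
  exists2 U, (0 < size U)%N &
    foldl (pair_succ B) (nondiagonal_vertices B) U = set0.
Proof.
split=> [[p [p0 [U /distinguishing_word U0]]]|[U U0 /distinguishing_word Ud]].
  by exists U; rewrite // size_tuple.
by exists (size U); split=> //; exists (in_tuple U).
Qed.

Lemma pair_transP s u t :
  pair_trans B s u = Some t <-> pair_succ B s u = t /\ t != set0.
Proof.
rewrite /pair_trans; case: ifP => [s0|/negbFE/eqP->]; split=> //.
- by case=> <-.
- by case=> ->.
- by case=> <-; rewrite eqxx.
Qed.

Lemma dfa_complete_pairP :
  dfa_complete (pair_dfa B) <->
  forall s u, s \in pair_states B -> pair_succ B s u != set0.
Proof.
split=> [compl s u /(compl s u)[t /pair_transP[-> //]]|compl s u ss].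
by exists (pair_succ B s u); apply/pair_transP; rewrite compl.
Qed.

Lemma pair_states_foldl s : s \in pair_states B ->
  exists U, s = foldl (pair_succ B) (nondiagonal_vertices B) U.
Proof.
rewrite inE => /connectP[p + ->]; elim/last_ind: p => [|p t IH].
  by exists [::].
rewrite rcons_path last_rcons => /andP[/IH[U ->] /existsP[u /eqP]].
by case/pair_transP=> <- _; exists (rcons U u); rewrite foldl_rcons.
Qed.

End PairGraph.

Theorem mainTheorem6 (n m q : nat) (hn : (0 < n)%N) (hm : (0 < m)%N)
    (hq : (0 < q)%N) (B : bcn n m q) :
  ~ type3_observable B <-> dfa_complete (pair_dfa B).
Proof.
apply: iff_trans (iff_sym (dfa_complete_pairP B)).
split=> [unobs s u /pair_states_foldl[U ->]|compl].
  apply/eqP=> U0; apply/unobs/type3_observableP; exists (rcons U u).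
    by rewrite size_rcons.
  by rewrite foldl_rcons.
case/type3_observableP=> U _ U0.
have reach : foldl (pair_succ B) (nondiagonal_vertices B) U \in pair_states B.
  elim/last_ind: U {U0} => [|U u IH]; first exact: pair_init_in.
  rewrite foldl_rcons; apply: (pair_trans_closed (u := u) IH).
  by apply/pair_transP; rewrite compl.
(* The successor of the empty set is empty, so completeness excludes it. *)
have /card_gt0P[u _] := @Delta_gt0 m.
have /set0Pn[w] := compl _ u reach.
by rewrite U0 inE => /andP[_ /existsP[v]]; rewrite inE.
Qed.
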